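(* Let $E$ be an $n$-dimensional vector space over a field $\mathbb{F}$. Let $(E,\mathcal{I})$ be a collection of independent spaces and let $(E,\mathcal{C})$ be a collection of circuits. 1. $(E,\mathcal{I})$ determines a $q$-matroid with collection of independent spaces $\mathcal{I}$ and collection of circuits $\mathcal{C}_{\mathcal{I}}$; that is, there is exactly one $q$-matroid $(E,r)$ whose collection of independent spaces is $\mathcal{I}$ and whose collection of circuits is $\mathcal{C}_{\mathcal{I}}$. 2. $(E,\mathcal{C})$ determines a $q$-matroid with collection of circuits $\mathcal{C}$ and collection of independent spaces $\mathcal{I}_{\mathcal{C}}$; that is, there is exactly one $q$-matroid $(E,r)$ whose collection of circuits is $\mathcal{C}$ and whose collection of independent spaces is $\mathcal{I}_{\mathcal{C}}$.
   Context: $n$ is a positive integer, $\mathbb{F}$ is an arbitrary field, and $\mathcal{L}(E)$ denotes the lattice of all subspaces of $E$; for a subspace $A$, $\mathcal{L}(A)$ is the set of all subspaces of $A$. For a family $\mathcal{A}\subseteq\mathcal{L}(E)$, $\max(\mathcal{A})$ is the set of members of $\mathcal{A}$ that are maximal with respect to inclusion. A $q$-matroid with ground space $E$ is a pair $(E,r)$ where $r$ is an integer-valued function on $\mathcal{L}(E)$ such that: (R1) $0\leq r(A)\leq\dim A$ for all $A$; (R2) $r(A)\leq r(B)$ for all $A\subseteq B$; (R3) $r(A+B)+r(A\cap B)\leq r(A)+r(B)$ for all $A,B$. A subspace $A$ is independent in $(E,r)$ if $r(A)=\dim A$ and dependent otherwise; a circuit is a dependent space that is minimal with respect to inclusion among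 dependent spaces. $(E,\mathcal{I})$ with $\mathcal{I}\subseteq\mathcal{L}(E)$ is a collection of independent spaces if: (I1) $\mathcal{I}\neq\emptyset$. (I2) For all $I,J\in\mathcal{L}(E)$, if $J\in\mathcal{I}$ and $I\subseteq J$, then $I\in\mathcal{I}$. (I3) For all $I,J\in\mathcal{I}$ with $\dim I<\dim J$, there exists a $1$-dimensional subspace $x\subseteq J$, $x\not\subseteq I$, such that $I+x\in\mathcal{I}$. (I4) For all $A,B\in\mathcal{L}(E)$ and $I,J\in\mathcal{L}(E)$ such that $I\in\max(\mathcal{I}\cap\mathcal{L}(A))$ and $J\in\max(\mathcal{I}\cap\mathcal{L}(B))$, there exists $K\in\max(\mathcal{I}\cap\mathcal{L}(A+B))$ such that $K\subseteq I+J$. $(E,\mathcal{C})$ with $\mathcal{C}\subseteq\mathcal{L}(E)$ is a collection of circuits if: (C1) $\{0\}\notin\mathcal{C}$. (C2) For all $C_1,C_2\in\mathcal{C}$, if $C_1\subseteq C_2$, then $C_1=C_2$. (C3) For distinct $C_1,C_2\in\mathcal{C}$ and any $X\in\mathcal{L}(E)$ of codimension $1$ in $E$, there is $C_3\in\mathcal{C}$ such that $C_3\subseteq(C_1+C_2)\cap X$. Define $\mathcal{C}_{\mathcal{I}}=\{C\in\mathcal{L}(E): C\notin\mathcal{I},\ I\in\mathcal{I}\text{ for all subspaces } I\subsetneq C\}$ and $\mathcal{I}_{\mathcal{C}}=\{I\in\mathcal{L}(E): C\not\subseteq I\text{ for all }C\in\mathcal{C}\}$. *)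

(* Defs.v *)
From mathcomp Require Import all_boot all_order all_algebra.
From mathcomp Require Import boolp classical_sets.

Set Implicit Arguments.
Unset Strict Implicit.
Unset Printing Implicit Defensive.

Import Order.TTheory GRing.Theory Num.Theory.
Local Open Scope ring_scope.
Local Open Scope classical_set_scope.

(* A family of subspaces of E is an arbitrary [set {vspace E}]: F may be
   infinite, and no decidability of membership is required. *)
Section QMatroids.
Variables (F : fieldType) (E : vectType F).
Implicit Types (A B C I J K X x : {vspace E}) (FI FC : set {vspace E}).

Definition subspaces A : set {vspace E} := [set B | (B <= A)%VS].

Definition max_members (FA : set {vspace E}) : set {vspace E} :=
  [set A | FA A /\ forall B, FA B -> (A <= B)%VS -> A = B].

(* The q-matroid (E, r) is represented by its rank function, the ground space
   being fixed. *)
Record is_qmatroid (r : {vspace E} -> int) : Prop := IsQMatroid {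
  qmatroid_R1 : forall A, 0 <= r A <= (\dim A)%:Z;
  qmatroid_R2 : forall A B, (A <= B)%VS -> r A <= r B;
  qmatroid_R3 : forall A B, r (A + B)%VS + r (A :&: B)%VS <= r A + r B
}.

Definition independents_of (r : {vspace E} -> int) : set {vspace E} :=
  [set A | r A = (\dim A)%:Z].

Definition dependents_of (r : {vspace E} -> int) : set {vspace E} :=
  ~` independents_of r.

Definition circuits_of (r : {vspace E} -> int) : set {vspace E} :=
  [set C | dependents_of r C /\
           forall A, dependents_of r A -> (A <= C)%VS -> A = C].

Record independence_axioms FI : Prop := IndependenceAxioms {
  indep_I1 : FI !=set0;
  indep_I2 : forall I J, FI J -> (I <= J)%VS -> FI I;
  indep_I3 : forall I J, FI I -> FI J -> (\dim I < \dim J)%N ->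
    exists x, [/\ \dim x = 1%N, (x <= J)%VS, ~ (x <= I)%VS & FI (I + x)%VS];
  indep_I4 : forall A B I J,
    max_members (FI `&` subspaces A) I ->
    max_members (FI `&` subspaces B) J ->
    exists K, max_members (FI `&` subspaces (A + B)%VS) K /\ (K <= I + J)%VS
}.

Record circuit_axioms FC : Prop := CircuitAxioms {
  circuit_C1 : ~ FC 0%VS;
  circuit_C2 : forall C1 C2, FC C1 -> FC C2 -> (C1 <= C2)%VS -> C1 = C2;
  circuit_C3 : forall C1 C2 X, FC C1 -> FC C2 -> C1 <> C2 ->
    (\dim X).+1 = \dim {:E} ->
    exists C3, FC C3 /\ (C3 <= (C1 + C2) :&: X)%VS
}.

Definition circuits_of_indep FI : set {vspace E} :=
  [set C | ~ FI C /\ forall I, (I <= C)%VS -> I <> C -> FI I].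

Definition indep_of_circuits FC : set {vspace E} :=
  [set I | forall C, FC C -> ~ (C <= I)%VS].

End QMatroids.

(* Main.v *)
Require Import Defs.
From mathcomp Require Import all_boot all_order all_algebra.
From mathcomp Require Import boolp classical_sets.
From mathcomp Require Import zify.

(** Uniqueness in both parts is the fact that a q-matroid is determined by its
    independent spaces: if [I] is maximal among the independent subspaces of
    [A], then [r A = \dim I] ([rank_basis]).

    For existence in part 1, (I3) says that the maximal independent subspaces
    of [A] all have the same dimension, which is taken as [r A].  For
    submodularity, extend a maximal independent subspace [I] of [A :&: B] to
    maximal ones [J] of [A] and [K] of [B].  By (I4), [r (A + B)] is the
    dimension of a subspace of [J + K], hence at most
    [\dim J + \dim K - \dim (J :&: K)], and [I <= J :&: K].

    Part 2 reduces to part 1 once the spaces containing no circuit are shown to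
    satisfy (I1)-(I4), since their minimal non-members are the given circuits.
    The engine is [unique_circuit]: adding one vector to an independent space
    creates at most one circuit.  It has two consequences.
    - The vectors [v] that lie in an independent [K] or make [K + <[v]>]
      dependent form a subspace ([spans_add]), as for the closure operator of a
      matroid.
    - If [I] and [J] are independent and [I] is not contained in [J], then [J]
      can be replaced by an independent subspace of [I + J] that is no smaller
      and meets [I] in more ([exchange_step]).  Iterating, an independent
      subspace of [A] has dimension at most that of any maximal one
      ([spans_dim]); this gives (I3).
    For (I4), a maximal independent subspace of [I + J] that contains [J] spans
    [A] by comparison of dimensions and spans [B] because [J] does, so it spans
    [A + B]. *)

Set Implicit Arguments.
Unset Strict Implicit.
Unset Printing Implicit Defensive.

Import Order.TTheory GRing.Theory Num.Theory.
Local Open Scope ring_scope.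
Local Open Scope classical_set_scope.

Section Proof.
Variables (F : fieldType) (E : vectType F).
Implicit Types (A B C I J K U W : {vspace E}) (FI FC P : set {vspace E}).
Implicit Types (v w : E).

(** * Lines and maximal members *)

Lemma dim_add_line U v : v \notin U -> \dim (U + <[v]>)%VS = (\dim U).+1.
Proof.
move=> vU; rewrite dimv_disjoint_sum ?dim_vline.
  have -> : v != 0 by apply: contraNneq vU => ->; exact: mem0v.
  by rewrite addn1.
apply/eqP; rewrite -subv0; apply/subvP => w; rewrite memv_cap memv0.
case/andP=> wU /vlineP[k wk]; case: (eqVneq k 0) => [k0|k0].
  by rewrite wk k0 scale0r.
by case/negP: vU; rewrite -[v]scale1r -(mulVf k0) -scalerA -wk memvZ.
Qed.

Lemma exists_notin U W : ~ (U <= W)%VS -> exists2 v, v \in U & v \notin W.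
Proof. by move=> /negP/subvPn[v vU vW]; exists v. Qed.

Lemma add_line_sub U W v :
  (U <= W)%VS -> v \in W -> (U + <[v]> <= W)%VS.
Proof. by move=> UW vW; rewrite subv_add UW -memvE. Qed.

Lemma mem_add_line U v : v \in (U + <[v]>)%VS.
Proof. by rewrite memvE addvSr. Qed.

Lemma max_members_ex P J :
  P J -> exists2 K, max_members P K & (J <= K)%VS.
Proof.
have [m] := ubnP (\dim {:E} - \dim J); elim: m J => // m IH J ltm PJ.
have [maxJ|nmaxJ] := pselect (max_members P J); first by exists J.
have [B [PB JB JnB]] : exists B, [/\ P B, (J <= B)%VS & J <> B].
  apply: contrapT => nB; apply: nmaxJ; split=> // B PB JB.
  by apply: contrapT => JnB; apply: nB; exists B.
have ltd : (\dim J < \dim B)%N.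
  rewrite ltn_neqAle dimvS // andbT; apply/eqP => dJB; apply: JnB; apply/eqP.
  by rewrite eqEdim JB dJB leqnn.
have dB : (\dim B <= \dim {:E})%N by rewrite dimvS ?subvf.
have [|//|K maxK BK] := IH B; first by lia.
by exists K => //; exact: subv_trans BK.
Qed.

(** * Spanning *)

(** The inclusion of [A] in the closure of [I], where closure is meant as in
    matroid theory. *)
Definition spans FI I A :=
  forall v, v \in A -> v \notin I -> ~ FI (I + <[v]>)%VS.

Lemma max_spans FI A I : max_members (FI `&` subspaces A) I -> spans FI I A.
Proof.
move=> [[_ IA] maxI] v vA vI FIv.
have := maxI (I + <[v]>)%VS (conj FIv (add_line_sub IA vA)) (addvSl _ _).
by move=> eI; move: vI; rewrite eI mem_add_line.
Qed.

Section DownClosed.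
Variable FI : set {vspace E}.
Hypothesis FI_sub : forall I J, FI J -> (I <= J)%VS -> FI I.

Lemma spans_max A I :
  FI I -> (I <= A)%VS -> spans FI I A -> max_members (FI `&` subspaces A) I.
Proof.
move=> FI_I IA spI; split=> // B [FB BA] IB.
apply/eqP; rewrite eqEsubv IB /=; apply/negPn/negP => /negP/exists_notin[v vB vI].
apply: (spI v (subvP BA v vB) vI); exact: FI_sub FB (add_line_sub IB vB).
Qed.

Lemma spans_mono I J A : (I <= J)%VS -> spans FI I A -> spans FI J A.
Proof.
move=> IJ spI v vA vJ FJ; apply: (spI v vA); last first.
  by apply: FI_sub FJ _; exact: addvS.
by apply: contra vJ; exact: (subvP IJ).
Qed.
End DownClosed.

(** * A q-matroid is determined by its independent spaces *)

(** Among the [J] with [I <= J <= A] and [r J = \dim I], a maximal one is [A]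
    itself: for [v] in [A] outside [J], maximality of [I] forces
    [r (I + <[v]>) = r I], and submodularity applied to [J] and [I + <[v]>]
    gives [r (J + <[v]>) = r J]. *)
Lemma rank_basis (r : {vspace E} -> int) A I : is_qmatroid r ->
  max_members (independents_of r `&` subspaces A) I -> r A = (\dim I)%:Z.
Proof.
move=> [R1 R2 R3] maxI; have [[rI IA] _] := maxI; rewrite /independents_of /= in rI.
have spI := max_spans maxI.
pose P : set {vspace E} := [set J | [/\ (I <= J)%VS, (J <= A)%VS & r J = (\dim I)%:Z]].
have [|J [[IJ JA rJ] maxJ] _] := @max_members_ex P I; first by split.
have [AJ|/exists_notin[v vA vJ]] := pselect (A <= J)%VS.
  by rewrite -rJ; congr r; apply/eqP; rewrite eqEsubv AJ.
have vI : v \notin I by apply: contra vJ; exact: (subvP IJ).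
have rIv : r (I + <[v]>)%VS <= (\dim I)%:Z.
  have /andP[_] := R1 (I + <[v]>)%VS.
  have := spI v vA vI; rewrite /independents_of /= dim_add_line //; lia.
have JIv : (J + (I + <[v]>) = J + <[v]>)%VS by rewrite addvA (addv_idPl IJ).
have := R3 J (I + <[v]>)%VS; rewrite JIv rJ => sub.
have rcap : r I <= r (J :&: (I + <[v]>))%VS.
  by apply: R2; rewrite subv_cap IJ addvSl.
have rJv : r J <= r (J + <[v]>)%VS by apply: R2; exact: addvSl.
have PJv : P (J + <[v]>)%VS.
  split; [exact: subv_trans IJ (addvSl _ _) | exact: add_line_sub|lia].
by move: vJ; rewrite (maxJ _ PJv (addvSl _ _)) mem_add_line.
Qed.

Lemma qmatroid_unique (r r' : {vspace E} -> int) :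
  is_qmatroid r -> is_qmatroid r' ->
  independents_of r = independents_of r' -> r = r'.
Proof.
move=> qr qr' eqI; apply: funext => A.
have r0 : independents_of r 0%VS.
  by have := qmatroid_R1 qr 0%VS; rewrite /independents_of /= dimv0; lia.
have [|I maxI _] := @max_members_ex (independents_of r `&` subspaces A) 0%VS.
  by split=> //; exact: sub0v.
by rewrite (rank_basis qr maxI) (rank_basis qr' (I := I)) -?eqI.
Qed.

(** * The rank function of a collection of independent spaces *)

Definition rank_of_indep FI A : int :=
  (\dim (xget 0%VS (max_members (FI `&` subspaces A))))%:Z.

Section RankOfIndependents.
Variable FI : set {vspace E}.
Hypothesis indepFI : independence_axioms FI.
Let r := rank_of_indep FI.

Lemma indep0 : FI 0%VS.
Proof.
have [I FI_I] := indep_I1 indepFI; exact: (indep_I2 indepFI) FI_I (sub0v _).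
Qed.

Lemma indep_extend A I : FI I -> (I <= A)%VS ->
  exists2 K, max_members (FI `&` subspaces A) K & (I <= K)%VS.
Proof. by move=> FI_I IA; apply: max_members_ex. Qed.

Lemma max_dim A I J : max_members (FI `&` subspaces A) I ->
  FI J -> (J <= A)%VS -> (\dim J <= \dim I)%N.
Proof.
move=> [[FI_I IA] maxI] FJ JA; rewrite leqNgt; apply/negP => ltIJ.
have [x [_ xJ xI FIx]] := indep_I3 indepFI FI_I FJ ltIJ.
apply: xI; rewrite (maxI (I + x)%VS) ?addvSl ?addvSr //.
by split=> //; rewrite /subspaces /= subv_add IA (subv_trans xJ).
Qed.

Lemma rank_of_max A I : max_members (FI `&` subspaces A) I -> r A = (\dim I)%:Z.
Proof.
move=> maxI; rewrite /r /rank_of_indep.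
have maxK := xgetPex 0%VS (ex_intro _ I maxI).
have [[FI_I IA] _] := maxI; have [[FK KA] _] := maxK.
by congr Posz; apply/eqP; rewrite eqn_leq (max_dim maxI FK KA) (max_dim maxK FI_I IA).
Qed.

Lemma rank_ex A : exists2 I, max_members (FI `&` subspaces A) I & r A = (\dim I)%:Z.
Proof.
have [I maxI _] := indep_extend indep0 (sub0v A).
by exists I => //; exact: rank_of_max.
Qed.

Lemma rank_of_indep_qmatroid : is_qmatroid r.
Proof.
split=> [A|A B AB|A B].
- have [I [[_ IA] _] ->] := rank_ex A; have := dimvS IA; lia.
- have [I [[FI_I IA] _] ->] := rank_ex A; have [J maxJ ->] := rank_ex B.
  by rewrite lez_nat; apply: max_dim maxJ FI_I _; exact: subv_trans AB.
have [I [[FI_I]]] := rank_ex (A :&: B)%VS.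
rewrite /subspaces /= subv_cap => /andP[IA IB] _ ->.
have [J maxJ IJ] := indep_extend FI_I IA.
have [K maxK IK] := indep_extend FI_I IB.
have [L [maxL LJK]] := indep_I4 indepFI maxJ maxK.
rewrite (rank_of_max maxJ) (rank_of_max maxK) (rank_of_max maxL).
have := dimv_sum_cap J K; have := dimvS LJK.
have /dimvS : (I <= J :&: K)%VS by rewrite subv_cap IJ.
lia.
Qed.

Lemma independents_of_rank : independents_of r = FI.
Proof.
apply/seteqP; split=> A; rewrite /independents_of /=.
  have [I [[FI_I IA] _] ->] := rank_ex A => -[dIA].
  suff <- : I = A by [].
  by apply/eqP; rewrite eqEdim dIA IA leqnn.
move=> FA; apply: rank_of_max; split=> [|B [_ BA] AB].
  by split=> //; exact: subvv.
by apply/eqP; rewrite eqEsubv AB.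
Qed.

End RankOfIndependents.

(** * Circuits *)

Lemma circuits_of_indepE (r : {vspace E} -> int) :
  circuits_of r = circuits_of_indep (independents_of r).
Proof.
apply/seteqP; split=> C [dC minC]; split=> // A.
  by move=> AC nAC; apply: contrapT => dA; exact/nAC/minC.
by move=> dA AC; apply: contrapT => nAC; exact/dA/minC.
Qed.

Section IndependentsOfCircuits.
Variable FC : set {vspace E}.
Hypothesis circuitFC : circuit_axioms FC.
Let FI := indep_of_circuits FC.

Lemma circuits_of_indep_of_circuits : circuits_of_indep FI = FC.
Proof.
apply/seteqP; split=> C.
  move=> [nFC minC]; apply: contrapT => nC; apply: nFC => D FD DC.
  have DnC : D <> C by move=> eDC; apply: nC; rewrite -eDC.
  exact: minC DC DnC D FD (subvv _).
move=> FCC; split=> [FIC|I IC InC D FD DI]; first exact: FIC FCC (subvv _).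
apply: InC; apply/eqP; rewrite eqEsubv IC /=.
by rewrite -(circuit_C2 circuitFC FD FCC (subv_trans DI IC)).
Qed.

Lemma not_indep A : ~ FI A -> exists2 C, FC C & (C <= A)%VS.
Proof.
by move=> nA; apply: contrapT => nC; apply: nA => C FCC CA; apply: nC; exists C.
Qed.

Lemma indep_sub I J : FI J -> (I <= J)%VS -> FI I.
Proof. by move=> FJ IJ C FCC CI; apply: (FJ C FCC); exact: subv_trans IJ. Qed.

(** Two distinct circuits in [S = I + <[v]>] would yield, by (C3), a third one in
    any hyperplane of [E].  Taking the hyperplane spanned by [I] and a complement
    of [S], which meets [S] in [I], this third circuit would lie in [I]. *)
Lemma unique_circuit I v C1 C2 : FI I -> FC C1 -> FC C2 ->
  (C1 <= I + <[v]>)%VS -> (C2 <= I + <[v]>)%VS -> C1 = C2.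
Proof.
move=> FI_I F1 F2; set S := (I + <[v]>)%VS => C1S C2S.
apply: contrapT => neq12.
have vI : v \notin I.
  apply/negP => vI; apply: (FI_I C1 F1); apply: subv_trans C1S _.
  exact: add_line_sub.
have IS : (I <= S)%VS by exact: addvSl.
pose X := (I + S^C)%VS.
have XS : (S :&: X <= I)%VS.
  apply/subvP => w; rewrite memv_cap => /andP[wS /memv_addP[i iI [c cS wE]]].
  have : c \in (S :&: S^C)%VS.
    rewrite memv_cap cS andbT; have -> : c = w - i by rewrite wE addrC addKr.
    by apply: memvB => //; exact: (subvP IS).
  by rewrite capv_compl memv0 => /eqP c0; rewrite wE c0 addr0.
have dX : (\dim X).+1 = \dim {:E}.
  rewrite dimv_disjoint_sum; last first.
    by apply/eqP; rewrite -subv0 -(capv_compl S) capvS.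
  rewrite dimv_compl dim_add_line //.
  have := dimvS (subvf S); rewrite dim_add_line //; lia.
have [C3 [F3]] := circuit_C3 circuitFC F1 F2 neq12 dX.
rewrite subv_cap => /andP[C3S C3X]; apply: (FI_I C3 F3).
apply: subv_trans XS; rewrite subv_cap C3X andbT.
by apply: subv_trans C3S _; rewrite subv_add C1S.
Qed.

(** Suppose [a] in [A] and [b] in [B] with [K + <[a + b]>] independent
    and neither [a] nor [b] in [K], the other cases being immediate.  Adding
    [a] to it gives a space containing [K + <[a]>] and [K + <[b]>], so the
    circuits of these two coincide and lie in their intersection.  That
    intersection is the independent space [K], unless [K + <[a]> = K + <[b]>],
    in which case [K + <[a + b]> = K + <[a]>] is dependent. *)
Lemma spans_add K A B : FI K -> spans FI K A -> spans FI K B ->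
  spans FI K (A + B)%VS.
Proof.
move=> FK spA spB z /memv_addP[a aA [b bB ->]] zK Fz.
have aK : a \notin K.
  apply/negP => aK; have bK : b \notin K by apply: contra zK => bK; exact: memvD.
  apply: (spB b bB bK); apply: indep_sub Fz _; apply: add_line_sub.
    exact: addvSl.
  have aKz : a \in (K + <[(a + b)%R]>)%VS by exact: (subvP (addvSl _ _)).
  by rewrite -(rpredDl _ aKz) mem_add_line.
have bK : b \notin K.
  apply/negP => bK; apply: (spA a aA aK); apply: indep_sub Fz _.
  apply: add_line_sub; first exact: addvSl.
  have bKz : b \in (K + <[(a + b)%R]>)%VS by exact: (subvP (addvSl _ _)).
  by rewrite -(rpredDr _ bKz) mem_add_line.
have [C FCC Ca] := not_indep (spA a aA aK).
have [D FD Db] := not_indep (spB b bB bK).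
have CD : C = D.
  apply: (unique_circuit (v := a) Fz FCC FD).
    by apply: subv_trans Ca _; rewrite addvS ?addvSl.
  apply: subv_trans Db _; apply: add_line_sub.
    by rewrite -addvA addvSl.
  rewrite -(rpredDl _ (mem_add_line (K + <[(a + b)%R]>) a)).
  exact/(subvP (addvSl _ _))/mem_add_line.
(* Whether [K + <[a]>] and [K + <[b]>] coincide. *)
have [bKa|bKa] := boolP (b \in (K + <[a]>)%VS).
  have sub : (K + <[(a + b)%R]> <= K + <[a]>)%VS.
    by apply: add_line_sub; [exact: addvSl | apply: memvD => //; exact: mem_add_line].
  have eqK : (K + <[(a + b)%R]> = K + <[a]>)%VS.
    by apply/eqP; rewrite eqEdim sub (dim_add_line aK) (dim_add_line zK) leqnn.
  by apply: (spA a aA aK); rewrite -eqK.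
apply: (FK C FCC); apply/subvP => w wC; move: (subvP Ca w wC) => wKa.
have : w \in (K + <[b]>)%VS by apply: (subvP Db); rewrite -CD.
case/memv_addP=> k kK [_ /vlineP[c ->] wE].
have [c0|c0] := eqVneq c 0; first by rewrite wE c0 scale0r addr0.
case/negP: bKa; rewrite -[b]scale1r -(mulVf c0) -scalerA memvZ //.
have -> : c *: b = w - k by rewrite wE addrC addKr.
by rewrite memvB // (subvP (addvSl _ _)).
Qed.

(** For [e] in [I] outside [J], the space [S = J + <[e]>] contains at most one
    circuit [C].  The space [W = (I :&: J) + <[e]>] lies in [I], so it cannot
    contain [C]; a hyperplane [T] of [S] that contains [W] but misses a vector of
    [C] is then independent, has the dimension of [J], and meets [I] in at least
    [W].  If [S] contains no circuit, [S] itself serves. *)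
Lemma exchange_step I J : FI I -> FI J -> ~ (I <= J)%VS ->
  exists T, [/\ FI T, (T <= I + J)%VS, (\dim J <= \dim T)%N
    & (\dim (I :&: J) < \dim (I :&: T))%N].
Proof.
move=> FI_I FJ /exists_notin[e eI eJ].
set W := (I :&: J + <[e]>)%VS; set S := (J + <[e]>)%VS.
have dW : \dim W = (\dim (I :&: J)).+1.
  by rewrite dim_add_line // memv_cap (negPf eJ) andbF.
have dS : \dim S = (\dim J).+1 by rewrite dim_add_line.
have WI : (W <= I)%VS by apply: add_line_sub; rewrite ?capvSl.
have WS : (W <= S)%VS by rewrite addvS ?capvSr.
have SIJ : (S <= I + J)%VS.
  by apply: add_line_sub; [exact: addvSr | exact: (subvP (addvSl _ _))].
suff [T [FT WT TS dT]] : exists T,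
    [/\ FI T, (W <= T)%VS, (T <= S)%VS & (\dim J <= \dim T)%N].
  exists T; split=> //; first exact: subv_trans SIJ.
  by rewrite -dW dimvS // subv_cap WI.
have [FS|/not_indep[C FCC CS]] := pselect (FI S).
  by exists S; split=> //; rewrite dS.
have /exists_notin[v vC vW] : ~ (C <= W)%VS.
  by move=> CW; apply: (FI_I C FCC); exact: subv_trans WI.
pose T := (W + (S :\: (W + <[v]>)))%VS.
have WvS : (W + <[v]> <= S)%VS by apply: add_line_sub => //; exact: (subvP CS).
have TvS : (T + <[v]> = S)%VS.
  by rewrite /T -addvA [(_ + <[v]>)%VS]addvC addvA addvC addv_diff; exact/addv_idPl.
have TS : (T <= S)%VS by rewrite -TvS addvSl.
have dT : \dim T = \dim J.
  have := dimv_cap_compl S (W + <[v]>)%VS; rewrite (capv_idPr WvS) dS dim_add_line //.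
  have : (\dim T <= \dim W + \dim (S :\: (W + <[v]>)))%N by exact: dimv_add_leqif.
  have : (\dim S <= \dim T + \dim <[v]>)%N by rewrite -TvS; exact: dimv_add_leqif.
  rewrite dim_vline dS; case: (v != 0); lia.
have vT : v \notin T.
  apply/negP => vT; have /dimvS : (S <= T)%VS by rewrite -TvS; exact: add_line_sub.
  by rewrite dS dT ltnn.
exists T; split=> //; [|exact: addvSl|by rewrite dT].
move=> D FD DT; case/negP: vT; apply: (subvP DT).
by rewrite -(unique_circuit FJ FCC FD CS (subv_trans DT TS)).
Qed.

(** Repeated exchange increases [\dim (I :&: J)] without decreasing [\dim J],
    until [J] contains [I] and hence equals it. *)
Lemma spans_dim A I J : FI I -> spans FI I A -> (I <= A)%VS ->
  FI J -> (J <= A)%VS -> (\dim J <= \dim I)%N.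
Proof.
move=> FI_I spI IA; have [m] := ubnP (\dim I - \dim (I :&: J)).
elim: m J => // m IH J ltm FJ JA.
have [IJ|nIJ] := pselect (I <= J)%VS.
  have [_ maxI] := spans_max indep_sub FI_I IA spI.
  by rewrite (maxI J).
have [T [FT TIJ dJT dIT]] := exchange_step FI_I FJ nIJ.
apply: leq_trans dJT _; apply: IH => //.
  have := dimvS (capvSl I T); lia.
by apply: subv_trans TIJ _; rewrite subv_add IA.
Qed.

Lemma spans_self I : spans FI I I.
Proof. by move=> v ->. Qed.

Lemma indep_of_circuits_axioms : independence_axioms FI.
Proof.
split.
- exists 0%VS => C FCC; rewrite subv0 => /eqP C0.
  by apply: (circuit_C1 circuitFC); rewrite -C0.
- exact: indep_sub.
- move=> I J FI_I FJ ltIJ; apply: contrapT => nx.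
  have spJ : spans FI I J.
    move=> v vJ vI FIv; apply: nx; exists <[v]>%VS; split=> //.
    + by rewrite dim_vline; case: eqP vI => // ->; rewrite mem0v.
    + by rewrite -memvE; exact/negP.
  have spIJ := spans_add FI_I (@spans_self I) spJ.
  by have := spans_dim FI_I spIJ (addvSl _ _) FJ (addvSr _ _); rewrite leqNgt ltIJ.
- move=> A B I J maxI maxJ.
  have [[FI_I IA] _] := maxI; have [[FJ JB] _] := maxJ.
  have [|K maxK IK] := @max_members_ex (FI `&` subspaces (I + J)%VS) I.
    by split=> //; exact: addvSl.
  have [|L maxL JL] := @max_members_ex (FI `&` subspaces (I + J)%VS) J.
    by split=> //; exact: addvSr.
  have [[FK KIJ] _] := maxK; have [[FL LIJ] _] := maxL.
  have spK : spans FI K (A + (I + J))%VS.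
    apply: spans_add => //; last exact: max_spans.
    apply: (spans_mono (@indep_sub) IK); exact: max_spans maxI.
  have KA : (K <= A + (I + J))%VS by apply: subv_trans KIJ (addvSr _ _).
  have LA : (L <= A + (I + J))%VS by apply: subv_trans LIJ (addvSr _ _).
  (* [K] spans [A + (I + J)], so its dimension, which is at most that of [L], bounds the
     independent subspaces there; hence [L] cannot be enlarged by a vector of
     [A]. *)
  have dKL : (\dim K <= \dim L)%N.
    exact: spans_dim FL (max_spans maxL) LIJ FK KIJ.
  have spLA : spans FI L A.
    move=> v vA vL FLv.
    have LvA : (L + <[v]> <= A + (I + J))%VS.
      by apply: add_line_sub => //; exact: (subvP (addvSl _ _)).
    by have := spans_dim FK spK KA FLv LvA; rewrite dim_add_line // ltnNge dKL.
  have spLB : spans FI L B := spans_mono indep_sub JL (max_spans maxJ).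
  exists L; split=> //; apply: spans_max => //; first exact: indep_sub.
    by apply: subv_trans LIJ (addvS _ _).
  exact: spans_add.
Qed.

End IndependentsOfCircuits.

End Proof.

Theorem corollary35 (F : fieldType) (E : vectType F) (n : nat)
    (n_gt0 : (0 < n)%N) (dimE : \dim (fullv : {vspace E}) = n)
    (FI FC : set {vspace E})
    (indepFI : independence_axioms FI) (circuitFC : circuit_axioms FC) :
  (exists! r : {vspace E} -> int,
      [/\ is_qmatroid r, independents_of r = FI
        & circuits_of r = circuits_of_indep FI]) /\
  (exists! r : {vspace E} -> int,
      [/\ is_qmatroid r, circuits_of r = FC
        & independents_of r = indep_of_circuits FC]).
Proof.
split.
  exists (rank_of_indep FI); split.
    split; [exact: rank_of_indep_qmatroid | exact: independents_of_rank |].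
    by rewrite circuits_of_indepE independents_of_rank.
  move=> r' [qr' Ir' _]; apply: qmatroid_unique => //.
    exact: rank_of_indep_qmatroid.
  by rewrite Ir' independents_of_rank.
have axI := indep_of_circuits_axioms circuitFC.
exists (rank_of_indep (indep_of_circuits FC)); split.
  split; [exact: rank_of_indep_qmatroid | | exact: independents_of_rank].
  by rewrite circuits_of_indepE independents_of_rank // circuits_of_indep_of_circuits.
move=> r' [qr' _ Ir']; apply: qmatroid_unique => //.
  exact: rank_of_indep_qmatroid.
by rewrite Ir' independents_of_rank.
Qed.
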